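(* Let $M$ be an isotropic $d\times d$ dilation matrix, let the scalar subdivision scheme $S_t=S_{t,M}$ associated with a trigonometric polynomial $t$ be uniformly convergent, and let $S_T=S_{T,M}$ be a $d\times d$ matrix subdivision scheme satisfying $$\triangledown S_t(f)=S_T(\triangledown f)\qquad\forall f\in\ell_\infty .$$ If the subdivision scheme $S_T$ normalized by $M$ uniformly subconverges on $\triangledown\ell_\infty$, then the function $S_t^\infty f$ is in $C^1(\mathbb{R}^d)$ for all $f\in\ell_\infty$.
   Context: A dilation matrix $M$ is a non-degenerate $d\times d$ integer matrix all of whose eigenvalues are larger than $1$ in modulus; $M^*$ is its transpose. $M$ is isotropic if there is a constant $C$ with $\|M^k\|_\infty\|M^{-k}\|_\infty\le C$ for all $k\in\mathbb{N}$. $\ell_\infty^N$ is the space of bounded sequences $f=\{f_\alpha\}_{\alpha\in\mathbb{Z}^d}$ with $f_\alpha\in\mathbb{R}^N$, normed by $\|f\|_\infty=\sup_\alpha|f_\alpha|$, where $|x|=\max_j|x_j|$; $\ell_\infty=\ell_\infty^1$. An $N\times N$ trigonometric matrix is $T(x)=\sum_{\alpha\in\mathbb{Z}^d}A_\alpha e^{-2\pi i(\alpha,x)}$, with $A_\alpha$ real $N\times N$ matrices, only finitely many non-zero (for $N=1$ this is a trigonometric polynomial $t$). The subdivision operator $S_T=S_{T,M}$ on $\ell_\infty^N$ is $(S_Tf)_\alpha=\sum_{\beta\in\mathbb{Z}^d}A_{\alpha-M\beta}f_\beta$, and the sequence $\{S_T^k\}_{k\ge1}$ is the ($N\times N$ matrix,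 or scalar if $N=1$) subdivision scheme $S_T$. For $f\in\ell_\infty$, $\triangledown f\in\ell_\infty^d$ is $(\triangledown f)_\alpha=(f_\alpha-f_{\alpha-\mathbf{e}_1},\dots,f_\alpha-f_{\alpha-\mathbf{e}_d})^T$; $\triangledown\ell_\infty=\{\triangledown f: f\in\ell_\infty\}$. A scalar scheme $S_t$ is uniformly convergent if for every $f\in\ell_\infty$ there is a continuous function $S_t^\infty f:\mathbb{R}^d\to\mathbb{R}$ with $\lim_{k\to\infty}\sup_{\alpha\in\mathbb{Z}^d}|(S_t^kf)_\alpha-(S_t^\infty f)(M^{-k}\alpha)|=0$, and for at least one $f\in\ell_\infty$ the function $S_t^\infty f$ is not identically zero. The $d\times d$ scheme $S_T$ normalized by $M$ is the sequence $\{{M^*}^kS_T^k\}_{k\ge1}$, where ${M^*}^k$ acts on each term of a sequence. It is uniformly subconvergent on a subspace $L\subseteq\ell_\infty^d$, $L\ne\{0\}$, if there is an infinite set $\mathfrak{N}\subset\mathbb{N}$ such that for every $F\in L$ there is a continuous function $S^\infty_{T/M}F:\mathbb{R}^d\to\mathbb{R}^d$ with $$\lim_{k\in\mathfrak{N},\,k\to\infty}\ \sup_{\alpha\in\mathbb{Z}^d}\big|({M^*}^kS_T^kF)_\alpha-(S^\infty_{T/M}F)(M^{-k}\alpha)\big|=0,$$ and for at least one $F\in L$ the limit $S^\infty_{T/M}F$ is not identically zero. *)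

(* Defs.v *)
From mathcomp Require Import all_boot all_order all_algebra.
From mathcomp Require Import finmap.
From mathcomp Require Import all_classical all_reals all_analysis.
From mathcomp Require Import complex.

Set Implicit Arguments.
Unset Strict Implicit.
Unset Printing Implicit Defensive.

Import Order.TTheory GRing.Theory Num.Theory.
Import numFieldNormedType.Exports.

Local Open Scope classical_set_scope.
Local Open Scope ring_scope.

Notation intmx R A := (map_mx (intr : int -> R) A).

Section DilationMatrices.
Variables (R : realType) (d : nat).

Definition dilation_matrix (M : 'M[int]_d) : Prop :=
  \det M != 0 /\
  forall z : R[i], eigenvalue (intmx R[i] M) z -> 1 < `|z|.

(* The operator norm induced by the norm max_j |x_j|, which is the norm of
   'cV[R]_d. *)
Definition opnorm (A : 'M[R]_d) : R :=
  sup [set `|A *m x| | x in [set x : 'cV[R]_d | `|x| <= 1]].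

Definition isotropic (M : 'M[int]_d) : Prop :=
  exists C : R, forall k : nat,
    opnorm (intmx R M ^+ k) * opnorm (invmx (intmx R M ^+ k)) <= C.

End DilationMatrices.

(* l_oo^N is the case V = 'cV[R]_N, and l_oo the case V = R. *)
Definition linfty (R : realType) (d : nat) (V : normedModType R) :
  set ('cV[int]_d -> V) := [set f | bounded_fun f].

Section Subdivision.
Variables (R : realType) (d : nat).

(* A trigonometric polynomial, resp. an N x N trigonometric matrix,
     T(x) = \sum_alpha A_alpha e^(-2 pi i (alpha, x)),
   is represented by its finitely supported family of real coefficients. *)
Definition trig_poly := {fsfun 'cV[int]_d -> R with 0}.
Definition trig_matrix (N : nat) := {fsfun 'cV[int]_d -> 'M[R]_N with 0}.

(* The sums over beta in Z^d are sums of finitely supported families as soon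
   as \det M != 0. *)
Definition subdiv (M : 'M[int]_d) (t : trig_poly) (f : 'cV[int]_d -> R) :
    'cV[int]_d -> R :=
  fun alpha => \sum_(beta \in [set: 'cV[int]_d]) t (alpha - M *m beta) * f beta.

Definition subdiv_mx (N : nat) (M : 'M[int]_d) (T : trig_matrix N)
    (f : 'cV[int]_d -> 'cV[R]_N) : 'cV[int]_d -> 'cV[R]_N :=
  fun alpha =>
    \sum_(beta \in [set: 'cV[int]_d]) T (alpha - M *m beta) *m f beta.

Definition grad (f : 'cV[int]_d -> R) : 'cV[int]_d -> 'cV[R]_d :=
  fun alpha => \col_j (f alpha - f (alpha - delta_mx j 0)).

Definition grad_linfty : set ('cV[int]_d -> 'cV[R]_d) :=
  grad @` linfty (V := R).

(* The supremum is taken in \bar R, since the real-valued sup of a set that is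
   not bounded above is 0. *)
Definition mesh_limit (V : normedModType R) (M : 'M[int]_d)
    (F : set_system nat) (u : nat -> 'cV[int]_d -> V) (g : 'cV[R]_d -> V) :=
  continuous g /\
  ereal_sup [set `|u k alpha - g (invmx (intmx R M ^+ k) *m intmx R alpha)|%:E
            | alpha in [set: 'cV[int]_d]] @[k --> F] --> 0%E.

(* g = S_t^oo f; such a g is unique when M is a dilation matrix. *)
Definition subdiv_limit (M : 'M[int]_d) (t : trig_poly)
    (f : 'cV[int]_d -> R) (g : 'cV[R]_d -> R) : Prop :=
  mesh_limit (V := R) M \oo (fun k => iter k (subdiv M t) f) g.

Definition uniformly_convergent (M : 'M[int]_d) (t : trig_poly) : Prop :=
  (forall f, linfty f -> exists g, subdiv_limit M t f g)
  /\ exists f g, [/\ linfty f, subdiv_limit M t f g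
                   & exists x, g x != 0].

Definition normalized_subdiv_limit (M : 'M[int]_d) (T : trig_matrix d)
    (K : set nat) (F : 'cV[int]_d -> 'cV[R]_d) (G : 'cV[R]_d -> 'cV[R]_d) :=
  mesh_limit M (within K \oo)
    (fun k alpha => (intmx R M)^T ^+ k *m iter k (subdiv_mx M T) F alpha) G.

Definition normalized_uniformly_subconvergent (M : 'M[int]_d)
    (T : trig_matrix d) (L : set ('cV[int]_d -> 'cV[R]_d)) : Prop :=
  exists K : set nat, [/\ infinite_set K,
    forall F, L F -> exists G, normalized_subdiv_limit M T K F G
    & exists F G, [/\ L F, normalized_subdiv_limit M T K F G
                    & exists x, G x != 0]].

Definition continuously_differentiable (g : 'cV[R]_d -> R) : Prop :=
  forall j : 'I_d, (forall x, derivable g x (delta_mx j 0)) /\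
    continuous (fun x => 'D_(delta_mx j 0) g x).

End Subdivision.

(* Main.v *)
Require Import Defs.
From mathcomp Require Import all_boot all_order all_algebra.
From mathcomp Require Import finmap complex perm zify ring lra.
From mathcomp Require Import all_classical all_reals all_analysis.

Set Implicit Arguments.
Unset Strict Implicit.
Unset Printing Implicit Defensive.

Import Order.TTheory GRing.Theory Num.Theory.
Import numFieldNormedType.Exports.

Local Open Scope classical_set_scope.
Local Open Scope ring_scope.

(** Write [A] for [M] over the reals, [f_k = S_t^k f] and [G] for the limit of
    the normalized matrix scheme applied to [grad f].  Iterating the
    intertwining relation gives [grad f_k = S_T^k (grad f)], so along the
    subsequence
      [(grad f_k)_c = (A^T)^-k (G (A^-k c) + o(1))]   uniformly in [c].
    In other words, on the mesh [A^-k Z^d] the function [f_k] has the increments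
    that a function with gradient [G] would have, and [G] is shown to be the
    gradient of [g].

    Given points [x] and [y], round [A^k x] and [A^k y] down to lattice points
    [X] and [Y] and walk from [X] to [Y] by unit steps inside the box around
    [Y].  After subtraction of the linear form [p : c |-> G(y) . A^-k c], each
    step changes [f_k - p] by at most a constant times [|A^-k| (w + o(1))],
    where [w] is the oscillation of [G] near [y], and there are
    [O(|A^k| |x - y| + 1)] steps.  Isotropy is exactly what bounds the product
    of the two operator norms, hence the total error by
    [O(|x - y|) (w + o(1))] ([discrete_taylor]).  The same bound on
    [|A^k| |A^-k|] keeps the walk, rescaled by [A^-k], within distance [O(|x - y|)] of [y].  Letting [k] tend
    to infinity along the subsequence, [f_k X - f_k Y] tends to [g x - g y] and
      [g x - g y = G(y) . (x - y) + o(|x - y|)]   ([limit_taylor]),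
    so that [g] has the continuous gradient [G].

    Rounding errors vanish because [A^-k] tends to [0].  This needs only
    determinants: [|det M| > 1] since it is the product of the moduli of the
    eigenvalues, so [|A^k|] tends to infinity, and by isotropy its inverse
    tends to [0] ([isotropic_invmx_small]). *)

(** * The operator norm *)

Section OperatorNorm.
Variable R : realType.

Lemma cV_norm_leP n (x : 'cV[R]_n) (c : R) : 0 <= c ->
  `|x| <= c <-> (forall i, `|x i 0| <= c).
Proof.
move=> c0; rewrite {1}/Num.Def.normr /= mx_normrE; split=> [h i|h].
  by apply: le_trans h; apply/bigmax_geP; right; exists (i, 0).
by apply: bigmax_le => //= -[i j] _; rewrite ord1.
Qed.

Lemma cV_coord_le n (x : 'cV[R]_n) i : `|x i 0| <= `|x|.
Proof. exact: (cV_norm_leP x (normr_ge0 x)).1. Qed.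

Lemma has_sup_opnorm d (A : 'M[R]_d) :
  has_sup [set `|A *m x| | x in [set x : 'cV[R]_d | `|x| <= 1]].
Proof.
split; first by exists `|A *m (0 : 'cV[R]_d)|; exists 0 => //=; rewrite normr0.
exists (\sum_i \sum_j `|A i j|) => _ [x /= x1 <-].
apply/cV_norm_leP => [|i]; first by do 2 apply: sumr_ge0 => ? _.
rewrite mxE (le_trans (ler_norm_sum _ _ _))// [leRHS](bigD1 i) //= ler_wpDr//.
  by do 2 apply: sumr_ge0 => ? _.
apply: ler_sum => j _; rewrite normrM ler_piMr//.
exact: le_trans (cV_coord_le x j) x1.
Qed.

Lemma opnorm_ge0 d (A : 'M[R]_d) : 0 <= opnorm A.
Proof.
have <- : `|A *m (0 : 'cV[R]_d)| = 0 by rewrite mulmx0 normr0.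
apply: ub_le_sup.
  by have [] := has_sup_opnorm A.
by exists 0 => //=; rewrite normr0.
Qed.

Lemma norm_mulmx_le d (A : 'M[R]_d) (x : 'cV[R]_d) :
  `|A *m x| <= opnorm A * `|x|.
Proof.
have [->|x0] := eqVneq x 0; first by rewrite mulmx0 !normr0 mulr0.
have xp : 0 < `|x| by rewrite normr_gt0.
rewrite -ler_pdivrMr// mulrC -[X in X * _]gtr0_norm ?invr_gt0//.
rewrite -normrZ scalemxAr; apply: ub_le_sup.
  by have [] := has_sup_opnorm A.
exists (`|x|^-1 *: x) => //=.
by rewrite normrZ gtr0_norm ?invr_gt0// mulVf ?gt_eqF.
Qed.

Lemma coef_le_opnorm d (A : 'M[R]_d) i j : `|A i j| <= opnorm A.
Proof.
have -> : A i j = (A *m (delta_mx j 0 : 'cV_d)) i 0 by rewrite -colE mxE.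
apply: le_trans (cV_coord_le _ i) _.
apply: le_trans (norm_mulmx_le A _) _.
rewrite ler_piMr ?opnorm_ge0//; apply/cV_norm_leP => // k.
by rewrite mxE normr_nat; case: (_ && _).
Qed.

(** Leibniz expansion: each of the [d`!] terms is a product of [d] entries. *)
Lemma norm_det_le d (A : 'M[R]_d) : `|\det A| <= d`!%:R * opnorm A ^+ d.
Proof.
apply: le_trans (ler_norm_sum _ _ _) _.
have -> : d`!%:R * opnorm A ^+ d = \sum_(s : 'S_d) opnorm A ^+ d.
  by rewrite sumr_const card_Sn mulr_natl.
apply: ler_sum => s _; rewrite normrM normr_sign mul1r normr_prod.
rewrite -[X in _ ^+ X](card_ord d) -prodr_const.
by apply: ler_prod => i _; rewrite normr_ge0 coef_le_opnorm.
Qed.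

Lemma dotmx_le d (p x : 'cV[R]_d) : `|(p^T *m x) 0 0| <= d%:R * (`|p| * `|x|).
Proof.
rewrite mxE; apply: le_trans (ler_norm_sum _ _ _) _.
rewrite -[X in X%:R](card_ord d) mulr_natl -sumr_const.
by apply: ler_sum => i _; rewrite mxE normrM ler_pM// cV_coord_le.
Qed.

End OperatorNorm.

(** * Dilation matrices *)

Lemma det_exprmx (F : comNzRingType) n (A : 'M[F]_n) k :
  \det (A ^+ k) = \det A ^+ k.
Proof.
elim: k => [|k ih]; first by rewrite !expr0 det1.
by rewrite !exprS det_mulmx ih.
Qed.

Section Dilation.
Variables (R : realType) (d : nat) (M : 'M[int]_d).

(** The determinant is, up to sign, the product of the complex eigenvalues. *)
Lemma dilation_det_gt1 : (0 < d)%N -> dilation_matrix R M -> 1 < `|\det M|.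
Proof.
move=> d0 [_ hev]; set A := intmx R[i] M.
have [rs ers] := closed_field_poly_normal (char_poly A).
rewrite (monicP (char_poly_monic A)) scale1r in ers.
have det_rs : `|\det A| = \prod_(z <- rs) `|z|.
  have -> : `|\det A| = `|(char_poly A)`_0|.
    by rewrite char_poly_det normrM normrX normrN1 expr1n mul1r.
  rewrite ers -horner_coef0 horner_prod normr_prod.
  by apply: eq_bigr => z _; rewrite !hornerE normrN.
have rs_gt1 z : z \in rs -> 1 < `|z|.
  move=> zrs; apply: hev; rewrite eigenvalue_root_char -/A ers.
  by rewrite root_prod_XsubC.
have sz : (0 < size rs)%N.
  by have := size_char_poly A; rewrite ers size_prod_XsubC => -[->].
have : 1 < `|\det A|.
  rewrite det_rs; case: rs sz rs_gt1 {ers det_rs} => // z rs _ h.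
  rewrite big_cons; apply: lt_le_trans (h z _) _; first exact: mem_head.
  rewrite ler_peMr //; elim: rs h => [|w rs ih] h; first by rewrite big_nil.
  rewrite big_cons mulr_ege1//; first by rewrite ltW// h// !inE eqxx orbT.
  by apply: ih => u; rewrite inE => /orP[/eqP->|us]; apply: h;
    rewrite !inE ?eqxx ?us ?orbT.
by rewrite det_map_mx -intr_norm ltr1z.
Qed.

Hypotheses (d0 : (0 < d)%N) (dilM : dilation_matrix R M).
Local Notation A := (intmx R M).

Lemma dilation_expr_unit k : A ^+ k \in unitmx.
Proof.
rewrite unitmxE det_exprmx det_map_mx unitfE expf_neq0// intr_eq0.
by case: dilM.
Qed.

(** Isotropy turns the lower bound on [opnorm (A ^+ k)] that follows from the
    growth of [\det (A ^+ k)] into an upper bound on the norm of the inverse. *)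
Lemma isotropic_invmx_small (isoM : isotropic R M) (e : R) : 0 < e ->
  \forall k \near \oo, opnorm (invmx (A ^+ k)) <= e.
Proof.
move=> e0; have [C hC] := isoM.
pose B := d`!%:R * (C / e) ^+ d.
have C0 : 0 <= C by apply: le_trans (hC 0%N); rewrite mulr_ge0 ?opnorm_ge0.
exists (Num.bound B) => // k /= hk; rewrite leNgt; apply/negP => big.
have small : opnorm (A ^+ k) <= C / e.
  rewrite ler_pdivlMr//; apply: le_trans (hC k).
  by rewrite ler_wpM2l ?opnorm_ge0// ltW.
have detB : `|\det (A ^+ k)| <= B.
  apply: le_trans (norm_det_le _) _; rewrite ler_wpM2l//.
  by rewrite lerXn2r// ?nnegrE ?opnorm_ge0// divr_ge0// ltW.
have : k%:R < `|\det (A ^+ k)| :> R.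
  have h2 : 2 <= `|(\det M)%:~R| :> R.
    rewrite -intr_norm (_ : 2 = 2%:~R :> R)// ler_int.
    exact: dilation_det_gt1.
  rewrite det_exprmx det_map_mx normrX; apply: lt_le_trans (_ : 2 ^+ k <= _).
    by rewrite -natrX ltr_nat ltn_expl.
  by rewrite lerXn2r// ?nnegrE.
move/lt_le_trans => /(_ _ detB); apply/negP; rewrite -leNgt.
apply: le_trans (ltW (archi_boundP _)) _; last by rewrite ler_nat.
by rewrite mulr_ge0// exprn_ge0// divr_ge0// ltW.
Qed.

End Dilation.

(** * Subdivision of bounded sequences *)

Section BoundedSequences.
Variables (R : realType) (d : nat).
Local Notation Zd := 'cV[int]_d.

Lemma linftyP (f : Zd -> R) :
  linfty f <-> exists B, forall alpha, `|f alpha| <= B.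
Proof.
split=> [[B [_ hB]]|[B hB]].
  by exists (B + 1) => alpha; apply: (hB (B + 1)); rewrite ?ltrDl.
exists B; split=> [|x Bx alpha _ /=]; first exact: num_real.
exact: le_trans (hB alpha) (ltW Bx).
Qed.

Lemma dilation_mulmx_inj (M : 'M[int]_d) : dilation_matrix R M ->
  injective (fun beta : Zd => M *m beta).
Proof.
move=> [det0 _] b1 b2 /(congr1 (fun v => \adj M *m v)).
rewrite !mulmxA !mul_adj_mx !mul_scalar_mx => /matrixP h.
apply/matrixP => i j; have := h i j; rewrite !mxE.
exact: mulfI.
Qed.

(** Since [M] is injective, the coefficients of [t] entering [(S_t f)_alpha]
    are pairwise distinct, so their absolute sum is at most that of [t]. *)
Lemma subdiv_linfty (M : 'M[int]_d) (t : trig_poly R d) (f : Zd -> R) :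
  dilation_matrix R M -> linfty f -> linfty (subdiv M t f).
Proof.
move=> dilM /linftyP[B hB]; apply/linftyP.
exists ((\sum_(gamma <- finsupp t) `|t gamma|) * B) => alpha.
have B0 : 0 <= B := le_trans (normr_ge0 _) (hB 0).
rewrite /subdiv; apply: le_trans (ler_norm_sum _ _ _) _.
set s := finite_support _ _ _.
have us : uniq s by exact: finite_support_uniq.
apply: le_trans (_ : (\sum_(b <- s) `|t (alpha - M *m b)|) * B <= _).
  by rewrite mulr_suml; apply: ler_sum => b _; rewrite normrM ler_wpM2l.
rewrite ler_wpM2r//.
rewrite -(big_map (fun b => alpha - M *m b) xpredT (fun g => `|t g|)).
set s' := map _ _.
have us' : uniq s'.
  rewrite map_inj_uniq// => b1 b2 /addrI /oppr_inj.
  exact: (dilation_mulmx_inj dilM).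
rewrite (bigID (fun g => g \in finsupp t)) /= [X in _ + X]big1 => [|g gt].
  2: by rewrite fsfun_dflt// normr0.
rewrite addr0 -big_filter.
rewrite [leRHS](bigID (fun g => g \in s')) /= -[X in _ <= X + _]big_filter.
rewrite ler_wpDr ?sumr_ge0//.
rewrite (perm_big [seq g <- finsupp t | g \in s'])//.
apply: uniq_perm; rewrite ?filter_uniq ?fset_uniq// => g.
by rewrite !mem_filter andbC.
Qed.

Lemma iter_subdiv_linfty (M : 'M[int]_d) (t : trig_poly R d) k (f : Zd -> R) :
  dilation_matrix R M -> linfty f -> linfty (iter k (subdiv M t) f).
Proof.
by move=> dilM hf; elim: k => //= k ih; apply: subdiv_linfty.
Qed.

Lemma grad_iter_subdiv (M : 'M[int]_d) (t : trig_poly R d)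
    (T : trig_matrix R d d) k (f : Zd -> R) :
  dilation_matrix R M ->
  (forall f, linfty f -> grad (subdiv M t f) = subdiv_mx M T (grad f)) ->
  linfty f ->
  grad (iter k (subdiv M t) f) = iter k (subdiv_mx M T) (grad f).
Proof.
move=> dilM hT hf; elim: k => //= k <-.
by apply: hT; apply: iter_subdiv_linfty.
Qed.

End BoundedSequences.

(** * Lattice walks *)

Section LatticeWalks.
Variables (R : realType) (d : nat).
Local Notation Zd := 'cV[int]_d.

Definition l1dist (a b : Zd) : nat := (\sum_i `|(a i 0 - b i 0)%R|)%N.

(** Walk from [a] to [b] along the lattice, changing one coordinate by one
    unit at a time and never leaving the box around [b]. *)
Lemma lattice_path_le (q : Zd -> R) (b : Zd) (N : nat) (eta : R) :
  (forall (c : Zd) j, (forall i, (`|(c i 0 - b i 0)%R| <= N)%N) ->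
     `|grad q c j 0| <= eta) ->
  forall a : Zd, (forall i, (`|(a i 0 - b i 0)%R| <= N)%N) ->
  `|q a - q b| <= (l1dist a b)%:R * eta.
Proof.
move=> hq a; move En : (l1dist a b) => n.
elim: n a En => [|n ih] a En ha.
  have -> : a = b.
    apply/matrixP => i j; rewrite ord1; apply/eqP.
    have /eqP := En; rewrite /l1dist sum_nat_eq0 => /forallP/(_ i).
    by rewrite implyTb absz_eq0 subr_eq0.
  by rewrite subrr normr0 mul0r.
have [j ajb] : exists j, a j 0 != b j 0.
  apply/existsP; apply: contraPT En; rewrite negb_exists => /forallP eq_ab.
  rewrite /l1dist big1// => i _; have := eq_ab i.
  by rewrite negbK => /eqP->; rewrite subrr.
pose e : Zd := delta_mx j 0.
pose s : int := if b j 0 < a j 0 then -1 else 1.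
have coord i : (a + s *: e) i 0 = a i 0 + s *+ (i == j).
  by rewrite !mxE eqxx andbT; case: (i == j); rewrite ?mulr1 ?mulr0.
have Edist : (`|((a + s *: e) j 0 - b j 0)%R|.+1 = `|(a j 0 - b j 0)%R|)%N.
  rewrite coord eqxx mulr1n /s; move: ajb; case: ltP => h; lia.
have ha' i : (`|((a + s *: e) i 0 - b i 0)%R| <= N)%N.
  have [->|ij] := eqVneq i j; last by rewrite coord (negbTE ij) addr0.
  by apply: leq_trans (ha j); rewrite -Edist.
have En' : l1dist (a + s *: e) b = n.
  apply/eq_add_S; rewrite -En /l1dist (bigD1 j)//= [in RHS](bigD1 j)//=.
  rewrite -Edist addSn; congr (_ + _).+1.
  by apply: eq_bigr => i ij; rewrite coord (negbTE ij) addr0.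
have step : `|q a - q (a + s *: e)| <= eta.
  rewrite /s; case: ltP => h.
    by have := hq a j ha; rewrite mxE scaleN1r.
  have := hq _ j ha'; rewrite mxE /s ltNge h /= scale1r addrK.
  by rewrite distrC.
rewrite (_ : q a - q b = (q a - q (a + s *: e)) + (q (a + s *: e) - q b)).
  2: by rewrite addrA subrK.
apply: le_trans (ler_normD _ _) _.
rewrite -(natr1 n) mulrDl mul1r addrC lerD//; exact: ih.
Qed.

(** Real-radius form of [lattice_path_le]: in a box of radius [r], the walk has
    at most [d * r] steps. *)
Lemma box_variation_le (q : Zd -> R) (b : Zd) (r eta : R) :
  0 <= r -> 0 <= eta ->
  (forall (c : Zd) j, `|intmx R c - intmx R b| <= r ->
     `|grad q c j 0| <= eta) ->
  forall a : Zd, `|intmx R a - intmx R b| <= r ->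
  `|q a - q b| <= d%:R * r * eta.
Proof.
move=> r0 eta0 hq a ha.
have boxE (c : Zd) : `|intmx R c - intmx R b| <= r <->
    forall i, (`|(c i 0 - b i 0)%R| <= Num.truncn r)%N.
  rewrite cV_norm_leP//; split=> h i; have := h i;
    by rewrite !mxE -rmorphB /= truncn_ge_nat// -intr_norm -pmulrn.
have /boxE ha' := ha.
have := lattice_path_le (q := q) (b := b) (N := Num.truncn r) (eta := eta) _ ha'.
move=> /(_ _)/le_trans; apply.
  by move=> c j /boxE; apply: hq.
rewrite ler_wpM2r//; apply: le_trans (_ : (d * Num.truncn r)%:R <= _).
  have -> : (d * Num.truncn r = \sum_(i < d) Num.truncn r)%N.
    by rewrite sum_nat_const card_ord.
  by rewrite ler_nat; apply: leq_sum.
by rewrite natrM ler_wpM2l// truncn_le.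
Qed.

Definition floor_cV (x : 'cV[R]_d) : Zd := map_mx Num.floor x.

Lemma floor_cV_dist (x : 'cV[R]_d) : `|intmx R (floor_cV x) - x| <= 1.
Proof.
apply/cV_norm_leP => // i; rewrite !mxE distrC.
have := floor_itv (x i 0); rewrite intrD => /andP[h1 h2].
by rewrite ger0_norm ?subr_ge0// lerBlDl ltW.
Qed.

(** With [A] a power of the dilation matrix and [B] its inverse, the hypothesis
    says that the normalized differences of [q] are within [eps] of [p] at
    every lattice point of the box that a walk from [Y] to [X] can visit.  The
    factor [opnorm A * opnorm B] of the conclusion is the one controlled by
    isotropy. *)
Lemma discrete_taylor (A B : 'M[R]_d) (q : Zd -> R) (p x y : 'cV[R]_d)
    (X Y : Zd) (eps : R) : B *m A = 1%:M -> 0 <= eps ->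
  (forall c : Zd,
     `|B *m intmx R c - y| <= opnorm B * (opnorm A * `|x - y| + 3) ->
     `|A^T *m grad q c - p| <= eps) ->
  `|intmx R X - A *m x| <= 1 -> `|intmx R Y - A *m y| <= 1 ->
  `|q X - q Y - (p^T *m (B *m intmx R X - B *m intmx R Y)) 0 0|
    <= d%:R * (opnorm A * `|x - y| + 2) * (d%:R * (opnorm B * eps)).
Proof.
move=> BA eps0 hq hX hY; have AB := mulmx1C BA.
pose r := opnorm A * `|x - y| + 2.
have r0 : 0 <= r by rewrite addr_ge0// mulr_ge0// opnorm_ge0.
(* Subtracting the linear form with the expected gradient leaves a sequence
   of small variation. *)
pose l (c : Zd) : R := (p^T *m (B *m intmx R c)) 0 0.
pose q' c := q c - l c.
have lB c1 c2 : l (c1 - c2) = l c1 - l c2.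
  by rewrite /l map_mxB !mulmxBr !mxE.
have -> : q X - q Y - (p^T *m (B *m intmx R X - B *m intmx R Y)) 0 0
    = q' X - q' Y.
  rewrite -mulmxBr -map_mxB -/(l _) lB /q'; ring.
apply: box_variation_le => //.
- by rewrite mulr_ge0// mulr_ge0// opnorm_ge0.
- move=> c j hc.
  have cball : `|B *m intmx R c - y| <= opnorm B * (opnorm A * `|x - y| + 3).
    have -> : B *m intmx R c - y = B *m (intmx R c - A *m y).
      by rewrite mulmxBr mulmxA BA mul1mx.
    apply: le_trans (norm_mulmx_le _ _) _; rewrite ler_wpM2l ?opnorm_ge0//.
    rewrite -(subrK (intmx R Y) (intmx R c)) -addrA.
    apply: le_trans (ler_normD _ _) _.
    by apply: le_trans (lerD hc hY) _; rewrite /r -addrA lerD2l; lra.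
  have Bj c1 : l (c1 - delta_mx j 0) = l c1 - (B^T *m p) j 0.
    rewrite lB; congr (_ - _); rewrite /l mulmxA.
    rewrite -[p^T *m B]trmxK trmx_mul trmxK.
    have -> : intmx R (delta_mx j 0 : Zd) = delta_mx j 0.
      by apply/matrixP => u v; rewrite !mxE; case: (_ && _).
    by rewrite -colE !mxE.
  have -> : grad q' c j 0 = (B^T *m (A^T *m grad q c - p)) j 0.
    rewrite mulmxBr mulmxA -trmx_mul AB trmx1 mul1mx.
    rewrite !mxE /q' Bj !mxE; ring.
  rewrite mxE; apply: le_trans (ler_norm_sum _ _ _) _.
  rewrite -[X in X%:R](card_ord d) mulr_natl -sumr_const.
  apply: ler_sum => i _; rewrite mxE normrM ler_pM ?coef_le_opnorm//.
  exact: le_trans (cV_coord_le _ i) (hq c cball).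
- rewrite (_ : _ - _ = A *m (x - y) + ((intmx R X - A *m x) - (intmx R Y - A *m y))).
    apply: le_trans (ler_normD _ _) _; rewrite lerD ?norm_mulmx_le//.
    by rewrite (_ : 2 = 1 + 1)// (le_trans (ler_normB _ _))// lerD//.
  by rewrite mulmxBr; apply/matrixP => i j; rewrite !mxE; ring.
Qed.

End LatticeWalks.

(** * First order expansion of the limit function *)

Section LimitFunction.
Variables (R : realType) (d : nat).
Local Notation Zd := 'cV[int]_d.

Lemma trmx_exprmx (A : 'M[R]_d) k : A^T ^+ k = (A ^+ k)^T.
Proof.
elim: k => [|k ih]; first by rewrite !expr0 trmx1.
by rewrite exprS ih exprSr; apply/esym; exact: trmx_mul.
Qed.

Lemma mesh_limit_near (V : normedModType R) (M : 'M[int]_d)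
    (F : set_system nat) {FF : Filter F} (u : nat -> Zd -> V)
    (g : 'cV[R]_d -> V) (e : R) : mesh_limit M F u g -> 0 < e ->
  \forall k \near F, forall alpha,
    `|u k alpha - g (invmx (intmx R M ^+ k) *m intmx R alpha)| <= e.
Proof.
move=> [_ h] e0.
have near0 : nbhs 0%E (fun y : \bar R => (y < e%:E)%E).
  by apply: open_ereal_lt'; rewrite lte_fin.
move: (h _ near0); rewrite nbhs_filterE; apply: (@filterS _ F FF) => k /= hk alpha; rewrite -lee_fin.
apply: le_trans (ltW hk); apply: ereal_sup_ubound.
by exists alpha.
Qed.

Lemma infinite_near_within (K : set nat) (P : set nat) :
  infinite_set K -> (\forall k \near within K \oo, P k) ->
  exists k, P k.
Proof.
move=> infK [N _ hN]; apply: contrapT => nP; apply: infK.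
apply: (sub_finite_set _ (finite_II N)) => k Kk /=.
by rewrite ltnNge; apply/negP => Nk; apply: nP; exists k; apply: hN.
Qed.

(** First order expansion at [y], obtained by applying [discrete_taylor] at one
    sufficiently large level [k] of the subsequence; how large depends on
    [x]. *)
Lemma limit_taylor (M : 'M[int]_d) (t : trig_poly R d) (T : trig_matrix R d d)
    (K : set nat) (f : Zd -> R) (g : 'cV[R]_d -> R)
    (G : 'cV[R]_d -> 'cV[R]_d) :
  (0 < d)%N -> dilation_matrix R M -> isotropic R M ->
  (forall k, grad (iter k (subdiv M t) f) = iter k (subdiv_mx M T) (grad f)) ->
  infinite_set K -> subdiv_limit M t f g ->
  normalized_subdiv_limit M T K (grad f) G ->
  forall (y : 'cV[R]_d) (eps : R), 0 < eps ->
  \forall x \near y,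
    `|g x - g y - ((G y)^T *m (x - y)) 0 0| <= eps * `|x - y|.
Proof.
move=> d0 dilM isoM gradE infK hg hG y eps eps0.
have [C hC] := isoM.
have C0 : 0 <= C by apply: le_trans (hC 0%N); rewrite mulr_ge0 ?opnorm_ge0.
pose D : R := d%:R.
have D0 : 0 <= D by [].
(* [Q] is the sum of the constants of the six error terms below: one for the
   walk, one for the linear term, two for [g] and two for [f_k]. *)
pose Q := 2 * D * D * (C + 1) + 5.
have DDC : 0 <= D * D * (C + 1) by rewrite !mulr_ge0// addr_ge0.
have Q0 : 0 < Q by rewrite /Q; lra.
pose e := eps / Q.
have e0 : 0 < e by rewrite divr_gt0.
have /cvgrPdist_le/(_ _ e0)/nbhs_ballP[dlt /= dlt0 Gy] := hG.1 y.
apply/nbhs_ballP; exists (dlt / (C + 1)) => /=.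
  by rewrite divr_gt0// ltr_wpDl.
move=> x; rewrite -ball_normE /= distrC => xy.
have [->|neq_xy] := eqVneq x y.
  by rewrite !subrr mulmx0 mxE subr0 !normr0 mulr0.
pose n := `|x - y|.
have n0 : 0 < n by rewrite normr_gt0 subr_eq0.
have en0 : 0 < e * n by rewrite mulr_gt0.
have /cvgrPdist_le/(_ _ en0)/nbhs_ballP[dx /= dx0 gx] := hg.1 x.
have /cvgrPdist_le/(_ _ en0)/nbhs_ballP[dy /= dy0 gy] := hg.1 y.
pose P := `|G y|.
pose pb := 2 * D * P + 1.
have P0 : 0 <= P := normr_ge0 _.
have DP0 : 0 <= D * P by rewrite mulr_ge0.
have pb0 : 0 < pb by rewrite /pb; lra.
(* [bet] bounds the norm of the inverse power: the first entry keeps the walk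
   in the ball where [G] is close to [G y], the second absorbs rounding in the
   linear term, the last two absorb rounding in the arguments of [g]. *)
pose bet := Num.min (Num.min (n / 3) (e * n / pb)) (Num.min (dx / 2) (dy / 2)).
have bet0 : 0 < bet by rewrite /bet !lt_min !divr_gt0//.
set A0 := intmx R M.
have hb : \forall k \near within K \oo, opnorm (invmx (A0 ^+ k)) <= bet.
  by apply: cvg_within; apply: isotropic_invmx_small.
have hf : \forall k \near within K \oo, forall alpha,
    `|iter k (subdiv M t) f alpha - g (invmx (A0 ^+ k) *m intmx R alpha)|
      <= e * n.
  by apply: cvg_within; apply: mesh_limit_near hg en0.
have hF : \forall k \near within K \oo, forall alpha,
    `|A0^T ^+ k *m iter k (subdiv_mx M T) (grad f) alpha
      - G (invmx (A0 ^+ k) *m intmx R alpha)| <= e.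
  by apply: mesh_limit_near hG e0.
have [k [[bk fk] Fk]] := infinite_near_within infK (filterI (filterI hb hf) hF).
set A := A0 ^+ k in bk fk Fk; set B := invmx A in bk fk Fk.
have BA : B *m A = 1%:M by rewrite mulVmx// dilation_expr_unit.
set b := opnorm B in bk.
have b0 : 0 <= b := opnorm_ge0 _.
move: bk; rewrite !le_min => /andP[/andP[b1 b2] /andP[b3 b4]].
have ab : opnorm A * b <= C := hC k.
have a0 : 0 <= opnorm A := opnorm_ge0 _.
pose X := floor_cV (A *m x); pose Y := floor_cV (A *m y).
have hX : `|intmx R X - A *m x| <= 1 := floor_cV_dist _.
have hY : `|intmx R Y - A *m y| <= 1 := floor_cV_dist _.
have near_pt (z : 'cV[R]_d) (Z : Zd) : `|intmx R Z - A *m z| <= 1 ->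
    `|B *m intmx R Z - z| <= b.
  move=> hZ; have -> : B *m intmx R Z - z = B *m (intmx R Z - A *m z).
    by rewrite mulmxBr mulmxA BA mul1mx.
  by apply: le_trans (norm_mulmx_le _ _) _; rewrite ler_piMr.
have BX := near_pt _ _ hX; have BY := near_pt _ _ hY.
pose q := iter k (subdiv M t) f.
have abn : opnorm A * b * n <= C * n by rewrite ler_wpM2r// ltW.
have b3n : b * 3 <= n by rewrite -ler_pdivlMr.
have path_err : `|q X - q Y - ((G y)^T *m (B *m intmx R X - B *m intmx R Y)) 0 0|
    <= 2 * D * D * (C + 1) * (e * n).
  have := discrete_taylor (q := q) (p := G y) (eps := 2 * e) BA _ _ hX hY.
  move=> /(_ _ _)/le_trans; apply.
  - by rewrite mulr_ge0// ltW.
  - move=> c hc.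
    rewrite -(subrK (G (B *m intmx R c)) (A^T *m _)) -addrA.
    apply: le_trans (ler_normD _ _) _.
    (* One [e] for the scheme at level [k], one for the oscillation of [G]. *)
    rewrite (_ : 2 * e = e + e); last by ring.
    apply: lerD.
      by have := Fk c; rewrite -gradE -/q trmx_exprmx.
    rewrite distrC; apply: Gy; rewrite -ball_normE /= distrC.
    apply: le_lt_trans hc _.
    move: xy; rewrite ltr_pdivlMr ?ltr_wpDl// -/n -/b => xy.
    by apply: le_lt_trans xy; lra.
  rewrite -/D -/n -/b.
  rewrite (_ : _ * _ * _ = D * D * 2 * e * (opnorm A * b * n + 2 * b)); last by ring.
  rewrite (_ : 2 * D * D * (C + 1) * (e * n) = D * D * 2 * e * (C * n + n)); last by ring.
  apply: ler_wpM2l; last by lra.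
  by rewrite mulr_ge0 ?(ltW e0)// !mulr_ge0.
have dot_err : `|((G y)^T *m ((B *m intmx R X - B *m intmx R Y) - (x - y))) 0 0|
    <= e * n.
  apply: le_trans (dotmx_le _ _) _; rewrite -/D -/P.
  have h : `|(B *m intmx R X - B *m intmx R Y) - (x - y)| <= 2 * b.
    rewrite (_ : _ - _ - _ = (B *m intmx R X - x) - (B *m intmx R Y - y)).
      by apply: le_trans (ler_normB _ _) _; lra.
    by apply/matrixP => i j; rewrite !mxE; ring.
  apply: le_trans (_ : D * (P * (2 * b)) <= _).
    by rewrite ler_wpM2l// ler_wpM2l.
  move: b2; rewrite ler_pdivlMr// /pb mulrDr mulr1; lra.
have gX : `|g x - g (B *m intmx R X)| <= e * n.
  apply: gx; rewrite -ball_normE /= distrC; apply: le_lt_trans BX _; lra.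
have gY : `|g y - g (B *m intmx R Y)| <= e * n.
  apply: gy; rewrite -ball_normE /= distrC; apply: le_lt_trans BY _; lra.
have fX := fk X; have fY := fk Y; rewrite -/q in fX fY.
have -> : eps * `|x - y| = Q * (e * n).
  by rewrite /e -/n mulrA [Q * _]mulrC divfK// gt_eqF.
have E : ((G y)^T *m ((B *m intmx R X - B *m intmx R Y) - (x - y))) 0 0
  = ((G y)^T *m (B *m intmx R X - B *m intmx R Y)) 0 0
    - ((G y)^T *m (x - y)) 0 0 by rewrite mulmxBr !mxE.
rewrite E in dot_err; rewrite /Q.
clear - path_err dot_err gX gY fX fY.
move: path_err dot_err gX gY fX fY.
rewrite !ler_norml => /andP[? ?] /andP[? ?] /andP[? ?] /andP[? ?] /andP[? ?] /andP[? ?].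
by apply/andP; split; lra.
Qed.

Lemma taylor_continuously_differentiable (g : 'cV[R]_d -> R)
    (G : 'cV[R]_d -> 'cV[R]_d) :
  continuous G ->
  (forall y eps, 0 < eps -> \forall x \near y,
    `|g x - g y - ((G y)^T *m (x - y)) 0 0| <= eps * `|x - y|) ->
  continuously_differentiable g.
Proof.
move=> Gc hT j.
have dq y : (fun h => h^-1 *: ((g \o shift y) (h *: (delta_mx j 0 : 'cV[R]_d)) - g y))
    @ 0^' --> G y j 0.
  apply/cvgrPdist_le => e e0.
  have n1 : `|delta_mx j 0 : 'cV[R]_d| <= 1.
    by apply/cV_norm_leP => // i; rewrite mxE normr_nat; case: (_ && _).
  have /nbhs_ballP[r r0 hr] := hT y e e0.
  apply/nbhs_ballP; exists r => // h hh hn0.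
  have hr' : ball y r (h *: (delta_mx j 0 : 'cV[R]_d) + y).
    move: hh; rewrite -!ball_normE /= sub0r normrN opprD addrCA subrr addr0.
    by rewrite normrN normrZ; apply: le_lt_trans; rewrite ler_piMr.
  have := hr _ hr'; rewrite /= addrK normrZ.
  rewrite -scalemxAr mxE -colE !mxE => hle.
  have hp : 0 < `|h| by rewrite normr_gt0.
  rewrite distrC; change (`|h^-1 * (g (h *: delta_mx j 0 + y) - g y) - G y j 0| <= e).
  rewrite -(ler_pM2l hp) -normrM mulrBr mulVKf//.
  apply: le_trans hle _; rewrite mulrC -mulrA ler_wpM2l//.
  by rewrite mulrC ler_piMr// ltW.
split=> [x|]; first by apply/cvg_ex; exists (G x j 0); exact: dq.
have -> : (fun x => 'D_(delta_mx j 0) g x) = (fun x => G x j 0).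
  by apply/funext => x; apply/cvg_lim => //; exact: dq.
move=> x; apply: (@continuous_comp _ _ _ G (fun v : 'cV[R]_d => v j 0)).
  exact: Gc.
exact: coord_continuous.
Qed.

End LimitFunction.

Theorem theorem15 (R : realType) (d : nat) (hd : (0 < d)%N) (M : 'M[int]_d)
  (hM : dilation_matrix R M) (hMiso : isotropic R M)
  (t : trig_poly R d) (ht : uniformly_convergent M t)
  (T : trig_matrix R d d)
  (hT : forall f : 'cV[int]_d -> R, linfty f ->
          grad (subdiv M t f) = subdiv_mx M T (grad f))
  (hsub : normalized_uniformly_subconvergent M T (@grad_linfty R d)) :
  forall (f : 'cV[int]_d -> R) (g : 'cV[R]_d -> R),
    linfty f -> subdiv_limit M t f g ->
    continuously_differentiable g.
Proof.
move=> f g hf hg.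
have [K [infK hK _]] := hsub.
have [G hG] : exists G, normalized_subdiv_limit M T K (grad f) G.
  by apply: hK; exists f.
apply: (taylor_continuously_differentiable hG.1).
apply: limit_taylor hg hG => // k.
exact: grad_iter_subdiv.
Qed.
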